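(* Let $d$ be even, $n\ge2$, let $\Lambda=(\lambda_1,\dots,\lambda_d)$ be a $d$-tuple of partitions of total size $n$, $n_i=|\lambda_i|$, and let $\widetilde{w_0}\in\mathbb S_n\subset C_d^n\rtimes\mathbb S_n$ be the longest element of $\mathbb S_n$, $\widetilde{w_0}=\prod_{i=1}^{\lfloor n/2\rfloor}(i,n+1-i)$. (a) If $n$ is even and not all $n_i$ are even, or if $n$ is odd and more than one $n_i$ is odd, then $\chi_\Lambda^0(\widetilde{w_0})=0$. (b) If $n$ is even and all $n_i$ are even, or if $n$ is odd and exactly one $n_i$ is odd, then $$\chi_\Lambda^0(\widetilde{w_0})=\frac{\lfloor n/2\rfloor!}{\prod_{i=1}^d\lfloor n_i/2\rfloor!}\;\prod_{i=1}^d\mathbb S^{\lambda_i}(\sigma_i),$$ where $\sigma_i\in\mathbb S_{n_i}$ is a product of $\lfloor n_i/2\rfloor$ disjoint transpositions.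
   Context: $C_d$ is the group of $d$-th roots of unity and $\mathbb S_n$ acts on $C_d^n$ by permuting coordinates. $\mathbb S^\lambda$ denotes the irreducible character of the symmetric group $\mathbb S_{|\lambda|}$ attached to the partition $\lambda$. For $\Lambda=(\lambda_1,\dots,\lambda_d)$ with $\sum|\lambda_i|=n$, let $N_i=C_d^{n_i}\rtimes\mathbb S_{n_i}$ and let $\chi_i$ be the character $(t_1,\dots,t_{n_i},\sigma)\mapsto \mathbb S^{\lambda_i}(\sigma)\prod_{j}t_j^{\,i}$ of $N_i$. Then $\chi_\Lambda^0=\mathrm{Ind}_{\prod_iN_i}^{C_d^n\rtimes\mathbb S_n}\bigotimes_i\chi_i$; these are the irreducible characters of $C_d^n\rtimes\mathbb S_n$. *)

(* Defs.v *)
From HB Require Import structures.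
From mathcomp Require Import all_boot all_order all_algebra.
From mathcomp Require Import all_fingroup all_solvable all_field all_character.
From mathcomp Require Import zify.

Set Implicit Arguments.
Unset Strict Implicit.
Unset Printing Implicit Defensive.

Import GRing.Theory Num.Theory.
Import GroupScope.

Local Open Scope ring_scope.

(* The exponent is d for every d > 0; writing it d.-1.+1 keeps the type finite
   for d = 0 as well. *)
Record rootU (d : nat) : predArgType :=
  RootU { rootU_val :> algC; _ : rootU_val ^+ d.-1.+1 == 1 }.

HB.instance Definition _ d := [isSub for @rootU_val d].
HB.instance Definition _ d := [Countable of rootU d by <:].

Lemma rootU_finite d : Finite.axiom
  (undup (pmap (insub : algC -> option (rootU d))
    [seq sval (C_prim_root_exists (ltn0Sn d.-1)) ^+ k | k <- iota 0 d.-1.+1])).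
Proof.
move=> x; rewrite count_uniq_mem ?undup_uniq // mem_undup mem_pmap_sub.
case: C_prim_root_exists => z pr_z; rewrite [sval _]/=; apply/eqP; rewrite eqb1.
have /eqP x1 := valP x; have [i ->] := prim_rootP pr_z x1.
by apply/mapP; exists (val i); rewrite // mem_iota add0n ltn_ord.
Qed.

HB.instance Definition _ d := isFinite.Build (rootU d) (@rootU_finite d).

Section RootUGroup.
Variable d : nat.
Implicit Types x y : rootU d.

Fact rootU_one_proof : (1 : algC) ^+ d.-1.+1 == 1.
Proof. by rewrite expr1n. Qed.
Fact rootU_mul_proof x y : ((x : algC) * y) ^+ d.-1.+1 == 1.
Proof. by rewrite exprMn (eqP (valP x)) (eqP (valP y)) mulr1. Qed.
Fact rootU_inv_proof x : ((x : algC)^-1) ^+ d.-1.+1 == 1.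
Proof. by rewrite exprVn (eqP (valP x)) invr1. Qed.

Definition rootU_one := RootU rootU_one_proof.
Definition rootU_mul x y := RootU (rootU_mul_proof x y).
Definition rootU_inv x := RootU (rootU_inv_proof x).

Fact rootU_mulA : associative rootU_mul.
Proof. by move=> x y z; apply: val_inj; rewrite /= mulrA. Qed.
Fact rootU_mul1 : left_id rootU_one rootU_mul.
Proof. by move=> x; apply: val_inj; rewrite /= mul1r. Qed.
Fact rootU_mulV : left_inverse rootU_one rootU_inv rootU_mul.
Proof.
move=> x; apply: val_inj; rewrite /= mulVf //; apply/negP => /eqP x0.
by have := valP x; rewrite /= x0 expr0n eq_sym oner_eq0.
Qed.

HB.instance Definition _ :=
  Finite_isGroup.Build (rootU d) rootU_mulA rootU_mul1 rootU_mulV.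

End RootUGroup.

Section Wreath.
Variables d n : nat.

(* Permutations compose from left to right in MathComp, so precomposition with
   the inverse is a right action. *)
Definition permute (t : {dffun 'I_n -> rootU d}) (s : 'S_n) :
  {dffun 'I_n -> rootU d} := [ffun j => t (s^-1%g j)].

Fact permute1 : permute^~ 1%g =1 id.
Proof. by move=> t; apply/ffunP => j; rewrite ffunE invg1 perm1. Qed.
Fact permuteM t : act_morph permute t.
Proof. by move=> s s'; apply/ffunP => j; rewrite !ffunE invMg permM. Qed.

Definition permute_action := TotalAction permute1 permuteM.

Fact permute_is_groupAction :
  is_groupAction [set: {dffun 'I_n -> rootU d}] permute_action.
Proof.
move=> s _; rewrite inE; apply/andP; split; first by apply/subsetP => t; rewrite !inE.
apply/morphicP => t t' _ _; rewrite !actpermE; apply/ffunP => j.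
by rewrite !mulg_ffun !ffunE.
Qed.

Definition permute_gact := GroupAction permute_is_groupAction.

(* An element u of [wreath] is a pair (u.1, u.2) : 'S_n * C_d^n standing for
   the product (sdpair2 u.1) * (sdpair1 u.2); it is the (t, sigma) of the usual
   notation with sigma = u.1 and t equal to u.2 up to a permutation of its
   coordinates, on which a product over all coordinates does not depend. *)
Definition wreath := sdprod_by permute_gact.
HB.instance Definition _ := FinGroup.on wreath.

Definition wr_perm (u : wreath) : 'S_n := u.1.
Definition wr_diag (u : wreath) : {dffun 'I_n -> rootU d} := u.2.
Definition wr_pair (s : 'S_n) (t : {dffun 'I_n -> rootU d}) : wreath :=
  (sdpair2 permute_gact s * sdpair1 permute_gact t)%g.
Definition wr_of_perm (s : 'S_n) : wreath := sdpair2 permute_gact s.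

Lemma wr_permM (u v : wreath) : wr_perm (u * v)%g = (wr_perm u * wr_perm v)%g.
Proof. by []. Qed.
Lemma wr_diagM (u v : wreath) :
  wr_diag (u * v)%g = (permute (wr_diag u) (wr_perm v) * wr_diag v)%g.
Proof. by []. Qed.
Lemma wr_perm_pair s t : wr_perm (wr_pair s t) = s.
Proof. by rewrite /wr_perm /wr_pair /= !val_insubd !inE /= mulg1. Qed.
Lemma wr_diag_pair s t : wr_diag (wr_pair s t) = t.
Proof.
rewrite /wr_diag /wr_pair /= !val_insubd !inE /=.
by apply/ffunP=> j; rewrite mulg_ffun !ffunE mul1g.
Qed.
Lemma wr_pairK (u : wreath) : wr_pair (wr_perm u) (wr_diag u) = u.
Proof. by rewrite [RHS]sdpairE. Qed.
Lemma wr_ext (u v : wreath) :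
  wr_perm u = wr_perm v -> wr_diag u = wr_diag v -> u = v.
Proof. by move=> es et; rewrite -[u]wr_pairK -[v]wr_pairK es et. Qed.

End Wreath.

Record intpart := IntPart {
  parts :> seq nat;
  _ : sorted geq parts && (0%N \notin parts) }.

Definition psize (la : intpart) : nat := sumn la.

Section Specht.
Variable la : intpart.
Let n := psize la.
Local Notation G := [set: 'S_n]%G.

(* The tableau of shape la filled with 0, .., n-1 row by row. *)
Definition tab_row (i : 'I_n) : nat := reshape_index la i.
Definition tab_col (i : 'I_n) : nat := reshape_offset la i.

Definition row_group : {set 'S_n} := [set s : 'S_n | [forall i, tab_row (s i) == tab_row i]].
Definition col_group : {set 'S_n} := [set s : 'S_n | [forall i, tab_col (s i) == tab_col i]].

(* The coordinates of the Young symmetrizer of this tableau in the regular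
   module of 'S_n. *)
Definition young_symmetrizer : 'rV[algC]_#|G| :=
  \sum_(p in row_group) \sum_(q in col_group)
     (-1) ^+ odd_perm q *: gring_row (regular_repr algC G (p * q)%g).

(* The character of the module that the Young symmetrizer generates inside the
   regular module; the trivial character for la = (n). *)
Definition specht_char : 'CF(G) :=
  cfRepr (submod_repr (cyclic_mx_module (regular_repr algC G) young_symmetrizer)).

End Specht.

Section Chi.
Variables (d : nat) (La : d.-tuple intpart).

Definition bsize (i : 'I_d) : nat := psize (tnth La i).

(* The exponent is i.+1 since 'I_d counts from 0 while the components of Lambda
   are numbered from 1 to d. *)
Definition chi_fun (i : 'I_d) (u : wreath d (bsize i)) : algC :=
  specht_char (tnth La i) (wr_perm u) * \prod_j (wr_diag u j : algC) ^+ i.+1.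

Fact chi_is_class_fun i :
  is_class_fun <<[set: wreath d (bsize i)]>> (finfun (chi_fun (i := i))).
Proof.
rewrite genGid; apply: intro_class_fun => [u v _ _|u]; last by rewrite inE.
have chiMC (x y : wreath d (bsize i)) : chi_fun (x * y)%g = chi_fun (y * x)%g.
  rewrite /chi_fun !wr_permM !wr_diagM; congr (_ * _).
    rewrite -(cfunJ _ (wr_perm x * wr_perm y)%g (in_setT (wr_perm x))).
    by rewrite conjgE mulgA mulKg.
  have prodP s (t t' : {dffun 'I_(bsize i) -> rootU d}) :
      \prod_j ((permute t s * t')%g j : algC) ^+ i.+1 =
      \prod_j (t j : algC) ^+ i.+1 * \prod_j (t' j : algC) ^+ i.+1.
    rewrite [X in X * _](reindex_inj (@perm_inj _ s^-1%g)) -big_split /=.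
    by apply: eq_bigr => j _; rewrite mulg_ffun ffunE -exprMn.
  by rewrite !prodP mulrC.
by rewrite conjgE chiMC mulgK.
Qed.

Definition chi (i : 'I_d) : 'CF([set: wreath d (bsize i)]) :=
  Cfun 0 (chi_is_class_fun i).

Definition block_prod := {dffun forall i : 'I_d, wreath d (bsize i)}.
HB.instance Definition _ := FinGroup.on block_prod.

Fact chi_tensor_is_class_fun :
  is_class_fun <<[set: block_prod]>>
    [ffun u : block_prod => \prod_i chi i (u i)].
Proof.
rewrite genGid; apply: intro_class_fun => [u v _ _|u]; last by rewrite inE.
apply: eq_bigr => i _; rewrite conjgE !mulg_ffun invg_ffun -conjgE.
by rewrite cfunJ // inE.
Qed.

Definition chi_tensor : 'CF([set: block_prod]) := Cfun 0 chi_tensor_is_class_fun.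

Variables (n : nat) (hn : (\sum_i bsize i = n)%N).

(* Cutting {0, .., n-1} into consecutive intervals of lengths bsize i: k is the
   element number [blk_off k] of the interval number [blk k]. *)
Definition blk (k : 'I_n) : 'I_d := tagnat.sig1 (cast_ord (esym hn) k).
Definition blk_off (k : 'I_n) : 'I_(bsize (blk k)) :=
  tagnat.sig2 (cast_ord (esym hn) k).
Definition blk_elt (i : 'I_d) (j : 'I_(bsize i)) : 'I_n :=
  cast_ord hn (tagnat.Rank i j).

Lemma blk_offK k : blk_elt (blk_off k) = k.
Proof. by rewrite /blk_elt tagnat.sig2K cast_ordKV. Qed.

Lemma blk_ind (P : 'I_n -> Prop) :
  (forall i (j : 'I_(bsize i)), P (blk_elt j)) -> forall k, P k.
Proof. by move=> Pij k; rewrite -(blk_offK k). Qed.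

(* Elimination of a family indexed by pairs (i, j) at the element number j of
   the interval number i. *)
Lemma blk_eltE T (F : forall i, 'I_(bsize i) -> T) i (j : 'I_(bsize i)) :
  F (blk (blk_elt j)) (blk_off (blk_elt j)) = F i j.
Proof.
rewrite /blk /blk_off /blk_elt cast_ordK.
transitivity (let p := tagnat.sig (tagnat.Rank i j) in F (tag p) (tagged p)) => //.
by rewrite /tagnat.Rank tagnat.rankK.
Qed.

Definition block_perm_fun (s : forall i, 'S_(bsize i)) (k : 'I_n) : 'I_n :=
  blk_elt (s (blk k) (blk_off k)).

Lemma block_perm_funE s i (j : 'I_(bsize i)) :
  block_perm_fun s (blk_elt j) = blk_elt (s i j).
Proof. exact: (blk_eltE (fun i j => blk_elt (s i j))). Qed.

Fact block_perm_inj s : injective (block_perm_fun s).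
Proof.
apply: (can_inj (g := block_perm_fun (fun i => (s i)^-1%g))).
by apply: blk_ind => i j; rewrite !block_perm_funE permK.
Qed.

(* The embedding of the product of the C_d^{n_i} ><| S_{n_i} in C_d^n ><| S_n. *)
Definition block_embed (u : block_prod) : wreath d n :=
  wr_pair (perm (@block_perm_inj (fun i => wr_perm (u i))))
          [ffun k => wr_diag (u (blk k)) (blk_off k)].

Lemma block_embed_perm u i (j : 'I_(bsize i)) :
  wr_perm (block_embed u) (blk_elt j) = blk_elt (wr_perm (u i) j).
Proof. by rewrite wr_perm_pair permE block_perm_funE. Qed.

Lemma block_embed_diag u i (j : 'I_(bsize i)) :
  wr_diag (block_embed u) (blk_elt j) = wr_diag (u i) j.
Proof.
by rewrite wr_diag_pair ffunE (blk_eltE (fun i j => wr_diag (u i) j)).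
Qed.

Lemma block_embedM : {in [set: block_prod] &, {morph block_embed : u v / (u * v)%g}}.
Proof.
move=> u v _ _; apply: wr_ext.
  apply/permP; apply: blk_ind => i j.
  by rewrite wr_permM permM !block_embed_perm mulg_ffun wr_permM permM.
apply/ffunP; apply: blk_ind => i j.
rewrite block_embed_diag (mulg_ffun i u v) (wr_diagM (u i)) (wr_diagM (block_embed u)).
rewrite [LHS]mulg_ffun [RHS]mulg_ffun block_embed_diag; congr (_ * _)%g; rewrite [LHS]ffunE [RHS]ffunE.
suff ->: (wr_perm (block_embed v))^-1%g (blk_elt j) =
         blk_elt ((wr_perm (v i))^-1%g j) by rewrite block_embed_diag.
by apply: (@perm_inj _ (wr_perm (block_embed v))); rewrite block_embed_perm !permKV.
Qed.

Canonical block_embed_morphism := Morphism block_embedM.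

Lemma blk_elt_inj i : injective (@blk_elt i).
Proof.
by move=> j j' /cast_ord_inj /tagnat.rank_inj /eqP; rewrite eq_Tagged => /eqP.
Qed.

Lemma block_embed_isom :
  isom [set: block_prod] (block_embed @* [set: block_prod]) block_embed.
Proof.
apply/isomP; split=> //; apply/injmP => u v _ _ e; apply/ffunP => i.
apply: wr_ext; [apply/permP => j; apply: (@blk_elt_inj i)|apply/ffunP => j].
  by rewrite -!block_embed_perm e.
by rewrite -!block_embed_diag e.
Qed.

(* cfIsom carries the tensor product of the chi_i to the image of the embedding. *)
Definition chi0 : 'CF([set: wreath d n]) :=
  'Ind[[set: wreath d n]] (cfIsom block_embed_isom chi_tensor).

End Chi.

Fact half_leq n : (n./2 <= n)%N.
Proof. by rewrite leq_half_double -addnn leqW ?leq_addr. Qed.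

(* The usual product of the transpositions (i, n+1-i), indices being shifted to
   start from 0; by w0E below it reverses the order, so that all pairs are
   inversions and it is the longest element. *)
Definition w0 (n : nat) : 'S_n :=
  (\prod_(i < n./2) tperm (widen_ord (half_leq n) i)
                          (rev_ord (widen_ord (half_leq n) i)))%g.

Lemma w0E n (k : 'I_n) : w0 n k = rev_ord k.
Proof.
suff H m (le_mn : (m <= n)%N) : (m <= n./2)%N ->
    (\prod_(i < m) tperm (widen_ord le_mn i) (rev_ord (widen_ord le_mn i)))%g k =
    if (k < m)%N || (rev_ord k < m)%N then rev_ord k else k.
  rewrite /w0 H //; case: ifPn => //; rewrite negb_or -!leqNgt /= => /andP[ge1 ge2].
  apply: val_inj => /=; have := ltn_ord k; have := odd_double_half n.
  by case: (odd n); rewrite -addnn; lia.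
elim: m le_mn => [|m IHm] le_mn le_m2; first by rewrite big_ord0 perm1.
rewrite big_ord_recr permM /=.
under eq_bigr => i _.
  rewrite (_ : widen_ord le_mn (widen_ord _ i) = widen_ord (ltnW le_mn) i);
    last exact: val_inj.
  over.
rewrite IHm; last exact: ltnW.
have lt_kn := ltn_ord k; have := odd_double_half n; rewrite -addnn => def_n.
set a := widen_ord le_mn ord_max; set b := rev_ord a.
have va : a = m :> nat by []; have vb : b = (n - m.+1)%N :> nat by [].
have vk : rev_ord k = (n - k.+1)%N :> nat by [].
case: ifPn => [lt_k | ge_k].
  rewrite tpermD; first by rewrite ifT //; lia.
    by apply/eqP => /(congr1 val) /=; lia.
  by apply/eqP => /(congr1 val) /=; lia.
have [ea | na] := eqVneq k a.
  by rewrite ea tpermL ifT //= ; lia.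
have [eb | nb] := eqVneq k b.
  by rewrite eb tpermR rev_ordK ifT //=; lia.
rewrite tpermD 1?eq_sym // ifF //.
have : (k : nat) <> m by move=> e; case/eqP: na; apply: val_inj.
have : (k : nat) <> (n - m.+1)%N by move=> e; case/eqP: nb; apply: val_inj.
by lia.
Qed.

Definition disjoint_transp (n m : nat) (s : 'S_n) : Prop :=
  exists r : seq ('I_n * 'I_n),
    [/\ size r = m, uniq (flatten [seq [:: x.1; x.2] | x <- r])
      & s = (\prod_(x <- r) tperm x.1 x.2)%g].

(* Main.v *)
Require Import Defs.
From mathcomp Require Import all_boot all_order all_algebra.
From mathcomp Require Import all_fingroup all_solvable all_field all_character.
From mathcomp Require Import zify.

Local Open Scope ring_scope.

Set Implicit Arguments.
Unset Strict Implicit.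
Unset Printing Implicit Defensive.

Import GRing.Theory Num.Theory.

(** The longest element w lies in the symmetric group and has at most one fixed
    point, and the character is induced from the subgroup H of those elements
    whose permutation part preserves the blocks of sizes n_1, .., n_d.  The
    cosets of H are the words of length n with n_i letters i, and w acts on
    them by reversal, so that the cosets fixed by w are the palindromes.

    Every fixed coset contributes the same amount.  A conjugate of w that lies
    in H restricts on each block to an involution with at most one fixed point,
    which is a product of n_i / 2 (rounded down) disjoint transpositions; such
    permutations of n_i points are all conjugate, and the coordinates in C_d
    contribute a factor 1.  Hence ([chi0_w0]) the value of the character is the
    number of palindromic words times the product of the values of the Specht
    characters.

    A palindrome has one letter of odd multiplicity if n is odd and none if n is
    even ([card_odd_letters]), which gives the vanishing.  Otherwise a palindrome
    is its first half, any word with n_i / 2 (rounded down) letters i, followed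
    by the letter of odd multiplicity, if there is one, and by the reversed half;
    the multinomial coefficient counts the halves
    ([count_palindromic_rearrangements]). *)

(** * Rearrangements of a word *)

Lemma sum_count_mem (T : finType) (s : seq T) :
  (\sum_(x : T) count_mem x s = size s)%N.
Proof.
elim: s => [|y s IHs] /=; first by rewrite big1.
by rewrite big_split /= IHs (bigD1 y) //= eqxx big1 // => x /negPf; rewrite eq_sym => ->.
Qed.

(** Sort the rearrangements of a word of length n by their first letter x: those
    of the word without one x are counted by induction, and multiplying by the
    missing factor, the multiplicity of x, leaves (n - 1)! times a sum of
    multiplicities, which is n. *)
Lemma multinomial_permutations (T : finType) (s : seq T) :
  (size (permutations s) * \prod_(x : T) (count_mem x s)`! = (size s)`!)%N.
Proof.
elim: {s}(size s) {-2}s (erefl (size s)) => [|n IHn] s size_s.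
  by move/size0nil: size_s => ->; rewrite /= big1.
have nt_s : (0 < size s)%N by rewrite size_s.
rewrite (perm_size (permutationsE nt_s)) size_allpairs_dep sumnE big_map big_distrl /=.
rewrite size_s factS -[in RHS]size_s -sum_count_mem big_distrl /=.
rewrite [RHS](bigID (mem s)) /= [X in (_ = _ + X)%N]big1 ?addn0; last first.
  by move=> x /count_memPn ->.
rewrite big_uniq ?undup_uniq //=.
apply: eq_big => [x|x]; first by rewrite mem_undup.
rewrite mem_undup => s_x.
have size_r : size (rem x s) = n by rewrite size_rem ?size_s.
rewrite -[in RHS]size_r -(IHn _ size_r).
rewrite mulnCA; congr (_ * _)%N.
rewrite (bigD1 x) //= [in RHS](bigD1 x) //= mulnA.
have cx : count_mem x s = (count_mem x (rem x s)).+1.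
  by rewrite -add1n (seq.permP (perm_to_rem s_x)) /= eqxx.
rewrite cx factS; congr (_ * _)%N; apply: eq_bigr => y /negPf ne_yx.
by rewrite (seq.permP (perm_to_rem s_x)) /= eq_sym ne_yx.
Qed.

(** * Palindromes *)

(** The middle c is meant to have at most one letter; this is written
    [size c = odd (size c)] below. *)
Definition palindrome_over (T : Type) (c g : seq T) : seq T := g ++ c ++ rev g.

Lemma palindromeP (T : eqType) (s : seq T) :
  rev s = s -> exists g c, [/\ size g = (size s)./2, size c = odd (size s)
                             & s = palindrome_over c g].
Proof.
move=> pal; set m := (size s)./2; set b := odd (size s).
have size_s : size s = (b + (m + m))%N by rewrite addnn odd_double_half.
exists (take m s), (take b (drop m s)); split.
- by rewrite size_takel // size_s; lia.
- by rewrite size_takel // size_drop size_s; lia.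
rewrite /palindrome_over -[LHS](cat_take_drop m); congr (_ ++ _).
rewrite -[LHS](cat_take_drop b); congr (_ ++ _).
rewrite rev_take pal drop_drop; congr (drop _ _); rewrite size_s; lia.
Qed.

Lemma count_palindrome (T : eqType) (x : T) (c g : seq T) :
  count_mem x (palindrome_over c g) = ((count_mem x g).*2 + count_mem x c)%N.
Proof. by rewrite !count_cat count_rev -addnn; lia. Qed.

Lemma rev_palindrome (T : Type) (c g : seq T) :
  size c = odd (size c) -> rev (palindrome_over c g) = palindrome_over c g.
Proof.
move=> small; rewrite /palindrome_over !rev_cat revK -catA; congr (_ ++ (_ ++ _)).
by case: c small => [|a [|b c]] //= /eqP; case: odd.
Qed.

Definition odd_letters (T : finType) (s : seq T) : {set T} :=
  [set x | odd (count_mem x s)].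

Lemma odd_letters_palindrome (T : finType) (c g : seq T) :
  size c = odd (size c) -> odd_letters (palindrome_over c g) =i c.
Proof.
move=> small x; rewrite inE count_palindrome oddD odd_double /=.
case: c small => [|a [|b c]] //= => [_|/eqP]; last by case: odd.
by rewrite mem_seq1 eq_sym; case: eqP.
Qed.

Lemma card_odd_letters (T : finType) (s : seq T) :
  rev s = s -> #|odd_letters s| = odd (size s).
Proof.
case/palindromeP => g [c [_ size_c def_s]].
have small : size c = odd (size c) by rewrite size_c oddb.
rewrite {1}def_s (eq_card (odd_letters_palindrome g small)) -size_c.
by apply/card_uniqP; case: c small {def_s size_c} => [|a [|b c]] //= /eqP; case: odd.
Qed.

Lemma exists_word (T : finType) (k : T -> nat) :
  exists s : seq T, forall x, count_mem x s = k x.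
Proof.
exists (flatten [seq nseq (k y) y | y <- enum T]) => x.
rewrite count_flatten -map_comp sumnE big_map big_enum /=.
rewrite (bigD1 x) //= big1 ?addn0 ?count_nseq /= ?eqxx ?mul1n // => y /negPf ne_yx.
by rewrite count_nseq /= ne_yx.
Qed.

(** A list without repetitions, so that its size is a number of words. *)
Definition palindromic_rearrangements (T : eqType) (s : seq T) : seq (seq T) :=
  [seq t <- permutations s | rev t == t].

(** The middle of such a palindrome is forced, since its only letter is the one
    of odd multiplicity, and its left half is an arbitrary rearrangement of the
    halved multiset of letters. *)
Lemma count_palindromic_rearrangements (T : finType) (s : seq T) :
    #|odd_letters s| = odd (size s) ->
  (size (palindromic_rearrangements s) * \prod_(x : T) (count_mem x s)./2`!
   = (size s)./2`!)%N.
Proof.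
move=> odd_s; have [h count_h] := exists_word (fun x : T => (count_mem x s)./2).
(* c is the common middle of all the palindromes, h one choice of a left half. *)
pose c := enum (odd_letters s).
have size_c : size c = odd (size s) by rewrite -cardE.
have small : size c = odd (size c) by rewrite size_c oddb.
have count_c x : count_mem x c = odd (count_mem x s).
  by rewrite count_uniq_mem ?enum_uniq // mem_enum inE.
have pal_h : perm_eq (palindrome_over c h) s.
  apply/allP => x _ /=; rewrite count_palindrome count_h count_c addnC.
  by rewrite odd_double_half.
have size_h : size h = (size s)./2.
  by rewrite -(perm_size pal_h) /palindrome_over !size_cat size_rev size_c
    addnCA addnn half_bit_double.
suff E : perm_eq (palindromic_rearrangements s)
                 [seq palindrome_over c g | g <- permutations h].
  rewrite (perm_size E) size_map -size_h -multinomial_permutations.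
  by congr (_ * _)%N; apply: eq_bigr => x _; rewrite count_h.
apply: uniq_perm => [||t]; first exact/filter_uniq/permutations_uniq.
  rewrite map_inj_in_uniq ?permutations_uniq // => g g'.
  rewrite !mem_permutations => /perm_size size_g /perm_size size_g'.
  by move/eqP; rewrite eqseq_cat ?size_g // => /andP[/eqP].
rewrite mem_filter mem_permutations; apply/andP/mapP => [[/eqP pal_t t_s]|[g]].
  have [g [c' [size_g size_c' def_t]]] := palindromeP pal_t.
  have small' : size c' = odd (size c') by rewrite size_c' oddb.
  have count_t x : ((count_mem x g).*2 + count_mem x c' = count_mem x s)%N.
    by rewrite -(seq.permP t_s) def_t count_palindrome.
  have odd_c' : odd_letters s =i c'.
    move=> x; rewrite -(odd_letters_palindrome g small') -def_t !inE.
    by rewrite (seq.permP t_s).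
  have def_c : c = c'.
    apply: perm_small_eq; first by rewrite size_c'; case: odd.
    apply: uniq_perm; first exact: enum_uniq.
      by case: (c') small' => [|a [|b l]] //= /eqP; case: odd.
    by move=> x; rewrite mem_enum odd_c'.
  exists g; last by rewrite def_c.
  rewrite mem_permutations; apply/allP => x _ /=; rewrite count_h.
  by rewrite -count_t -def_c count_c addnC half_bit_double.
rewrite mem_permutations => g_h ->; rewrite rev_palindrome ?eqxx //; split=> //.
rewrite -(permPr pal_h); apply/allP => x _ /=.
by rewrite !count_palindrome (seq.permP g_h).
Qed.

(** * Involutions with at most one fixed point *)

(** Unlike a cycle type, this property passes without any counting to the
    restriction to a stable block, and it still determines the conjugacy class. *)
Definition near_fixfree_involution n (s : 'S_n) : Prop :=
  involutive s /\ (forall i j, s i = i -> s j = j -> i = j).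

(** One more point x is sent to x' by composing with the transposition of x'
    and the present image of x, neither of which occurs in the images of the
    other points. *)
Lemma perm_extends_uniq (T : finType) (l l' : seq T) :
  uniq l -> uniq l' -> size l = size l' -> exists s : {perm T}, map s l = l'.
Proof.
elim: l l' => [|x l IHl] [|x' l'] //=; first by exists 1%g.
move=> /andP[l'x Ul] /andP[l'x' Ul'] [/(IHl _ Ul Ul')[s def_l']].
exists (s * tperm (s x) x')%g; rewrite permM tpermL; congr (_ :: _).
rewrite -def_l'; apply/eq_in_map => y ly; rewrite permM tpermD //.
  by apply: contraNneq l'x => /perm_inj->.
by apply: contraNneq l'x' => ->; rewrite -def_l' map_f.
Qed.

Definition points (T : Type) (r : seq (T * T)) : seq T :=
  flatten [seq [:: x.1; x.2] | x <- r].

Definition tperms (T : finType) (r : seq (T * T)) : {perm T} :=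
  (\prod_(x <- r) tperm x.1 x.2)%g.

Lemma size_points (T : Type) (r : seq (T * T)) : size (points r) = (size r).*2.
Proof. by elim: r => //= x r; rewrite doubleS => <-. Qed.

Lemma tperms_out (T : finType) (r : seq (T * T)) x :
  x \notin points r -> tperms r x = x.
Proof.
rewrite /tperms; elim: r => [|[a b] r IHr]; first by rewrite big_nil perm1.
rewrite big_cons permM /= !inE !negb_or => /and3P[na nb /IHr out].
by rewrite tpermD // eq_sym.
Qed.

Lemma tperms_in (T : finType) (r : seq (T * T)) a b :
  uniq (points r) -> (a, b) \in r -> tperms r a = b /\ tperms r b = a.
Proof.
elim: r => // -[a' b'] r IHr /=.
rewrite !inE negb_or => /and3P[/andP[ne_ab ra'] rb' Ur].
rewrite /tperms big_cons !permM /=.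
have inP c e : (c, e) \in r -> (c \in points r) && (e \in points r).
  move=> rce; apply/andP; split; apply/flattenP; exists [:: c; e];
    rewrite ?inE ?eqxx ?orbT //; exact: (map_f (fun x => [:: x.1; x.2]) rce).
case/orP => [/eqP[-> ->] | rab].
  by rewrite tpermL tpermR !tperms_out.
have /andP[ra rb] := inP _ _ rab.
rewrite !tpermD; first exact: IHr.
all: by [apply: contraNneq ra' => -> | apply: contraNneq rb' => ->].
Qed.

Lemma conjg_tperms (T : finType) (r : seq (T * T)) (s : {perm T}) :
  (tperms r ^ s)%g = tperms [seq (s x.1, s x.2) | x <- r].
Proof.
rewrite /tperms big_map; elim: r => [|x r IHr]; first by rewrite !big_nil conj1g.
by rewrite !big_cons conjMg IHr tpermJ.
Qed.

(** Conjugation relabels the points of the transpositions, and any list of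
    distinct points can be relabelled as any other of the same length. *)
Lemma disjoint_transp_conj n m (s s' : 'S_n) :
  disjoint_transp m s -> disjoint_transp m s' -> exists x, s' = (s ^ x)%g.
Proof.
case=> r [size_r Ur ->] [r' [size_r' Ur' ->]].
have [|x def_r'] := perm_extends_uniq Ur Ur'.
  by rewrite [LHS]size_points [RHS]size_points size_r size_r'.
exists x; rewrite [RHS]conjg_tperms -/(tperms r'); congr tperms.
elim: r r' {size_r size_r' Ur Ur'} def_r' => [|[a b] r IHr] [|[a' b'] r'] //=.
by case=> <- <- /IHr <-.
Qed.

(** The transpositions pair each i such that i < s i with s i; all other points
    are such an s i or fixed, and a single fixed point is lost in the rounding of
    n / 2. *)
Lemma near_fixfree_disjoint_transp n (s : 'S_n) :
  near_fixfree_involution s -> disjoint_transp n./2 s.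
Proof.
case=> sK fix_s; pose A := [set i : 'I_n | (i < s i)%N].
pose r := [seq (i, s i) | i <- enum A].
have mem_r i : (i \in points r) = (s i != i).
  apply/flattenP/idP => [[_ /mapP[_ /mapP[j + ->] ->]]|].
    rewrite mem_enum !inE /= => lt_j /orP[]/eqP->; rewrite ?sK -val_eqE /=; lia.
  rewrite neq_ltn => /orP[lt_i | lt_i].
    exists [:: s i; i]; last by rewrite !inE eqxx orbT.
    apply/mapP; exists (s i, i) => //; apply/mapP; exists (s i); rewrite ?sK //.
    by rewrite mem_enum inE sK.
  exists [:: i; s i]; last by rewrite !inE eqxx.
  by apply/mapP; exists (i, s i) => //; apply/mapP; exists i; rewrite ?mem_enum ?inE.
have Ur : uniq (points r).
  have: perm_eq (points r) (enum A ++ map s (enum A)).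
    apply/allP => x _; rewrite /r; elim: (enum A) => //= a l IHl.
    by move: IHl; rewrite /= !count_cat /= => /eqP ->; apply/eqP; lia.
  move/perm_uniq->; rewrite cat_uniq enum_uniq map_inj_uniq ?enum_uniq ?andbT /=;
    last exact: perm_inj.
  apply/hasPn => _ /mapP[j + ->]; rewrite /= !mem_enum !inE sK; lia.
exists r; split=> //.
  (* The points of r and the fixed points of s are complementary. *)
  have: (#|points r| + #|[set i : 'I_n | s i == i]| = n)%N.
    rewrite -[RHS]card_ord -(cardC (mem (points r))); congr (_ + _)%N.
    by apply: eq_card => i; rewrite !inE mem_r negbK.
  have /card_uniqP-> := Ur; rewrite size_points => def_n.
  have: (#|[set i : 'I_n | s i == i]| <= 1)%N.
    by apply/card_le1_eqP => i j; rewrite !inE => /eqP ? /eqP ?; apply: fix_s.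
  rewrite -(congr1 half def_n) {def_n}; case: #|_| => [|[|k]] // _.
    by rewrite addn0 doubleK.
  by rewrite addn1 -[_.+1]/(true + (size r).*2)%N half_bit_double.
apply/permP => i; have [out | inr] := boolP (s i == i).
  by rewrite [RHS]tperms_out ?(eqP out) // mem_r negbK.
have [lt_i | lt_i] : (i < s i)%N \/ (s i < i)%N.
    by apply/orP; rewrite -neq_ltn eq_sym.
  have [] // := @tperms_in _ r i (s i) Ur.
  by apply/mapP; exists i; rewrite ?mem_enum ?inE.
have [] // := @tperms_in _ r (s i) i Ur.
by apply/mapP; exists (s i); rewrite ?mem_enum ?inE sK.
Qed.

Lemma w0_near_fixfree n : near_fixfree_involution (w0 n).
Proof.
split=> [i | i j]; rewrite !w0E ?rev_ordK //.
move=> /(congr1 (@nat_of_ord n)) + /(congr1 (@nat_of_ord n)).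
by move=> /= ei ej; apply: ord_inj; move: (ltn_ord i) (ltn_ord j); lia.
Qed.

Lemma near_fixfree_conj n (s t : 'S_n) :
  near_fixfree_involution s -> near_fixfree_involution (s ^ t)%g.
Proof.
case=> sK fix_s; split=> [i | i j].
  by rewrite -[i](permKV t) !permJ sK.
rewrite -[i](permKV t) -[j](permKV t) !permJ => /perm_inj/fix_s fi.
by move=> /perm_inj/fi->.
Qed.

Lemma specht_char_near_fixfree (la : intpart) (s sigma : 'S_(psize la)) :
  near_fixfree_involution s -> disjoint_transp (psize la)./2 sigma ->
  specht_char la s = specht_char la sigma.
Proof.
move=> /near_fixfree_disjoint_transp ds /(disjoint_transp_conj ds)[x ->].
by rewrite cfunJ ?inE.
Qed.

(** * The subgroup from which the character is induced *)

Lemma wr_diag_of_perm d n (s : 'S_n) j : wr_diag (wr_of_perm d s) j = 1%g.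
Proof. by rewrite /wr_diag /wr_of_perm /= val_insubd !inE /= ffunE. Qed.

Lemma wr_perm_of_perm d n (s : 'S_n) : wr_perm (wr_of_perm d s) = s.
Proof. by rewrite /wr_perm /wr_of_perm /= val_insubd !inE /=. Qed.

Section BlockSubgroup.
Variables (d : nat) (La : d.-tuple intpart) (n : nat).
Hypothesis hn : (\sum_i bsize La i = n)%N.
Local Notation blk := (blk hn).
Local Notation blk_elt := (@blk_elt d La n hn).
Local Notation H := (block_embed hn @* [set: block_prod La])%g.

Lemma blk_blk_elt i (j : 'I_(bsize La i)) : blk (blk_elt j) = i.
Proof. exact: (blk_eltE hn (fun i _ => i)). Qed.

Lemma blk_eltP i k : blk k = i -> exists j : 'I_(bsize La i), blk_elt j = k.
Proof. by move=> <-; exists (blk_off hn k); rewrite blk_offK. Qed.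

Definition young : {set 'S_n} := [set s : 'S_n | [forall k, blk (s k) == blk k]].

Lemma youngP (s : 'S_n) : reflect (forall k, blk (s k) = blk k) (s \in young).
Proof. by rewrite inE; apply: eqfunP. Qed.

Lemma block_embed_young (v : block_prod La) : wr_perm (block_embed hn v) \in young.
Proof.
apply/youngP; apply: (blk_ind (hn := hn)) => i j.
by rewrite block_embed_perm !blk_blk_elt.
Qed.

(** The default value in the definition of the restriction is never reached,
    because the image of an element of a block is in the same block. *)
Lemma young_restrict (s : 'S_n) : s \in young ->
  exists t : forall i, 'S_(bsize La i),
    forall i (j : 'I_(bsize La i)), blk_elt (t i j) = s (blk_elt j).
Proof.
move=> /youngP Ys.
pose r i (j : 'I_(bsize La i)) := odflt j [pick j' | blk_elt j' == s (blk_elt j)].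
have rE i j : blk_elt (@r i j) = s (blk_elt j).
  rewrite /r; case: pickP => [j' /eqP // | no]; have := Ys (blk_elt j).
  by rewrite blk_blk_elt => /blk_eltP[j' /eqP]; rewrite no.
have r_inj i : injective (@r i).
  move=> j j' eq_r; apply: (@blk_elt_inj _ _ _ hn i).
  by apply: (@perm_inj _ s); rewrite -!rE eq_r.
by exists (fun i => perm (@r_inj i)) => i j; rewrite permE rE.
Qed.

(** No condition bears on the coordinates in C_d: the subgroup is the preimage of
    the Young subgroup of the symmetric group. *)
Lemma mem_block_subgroup (u : wreath d n) : (u \in H) = (wr_perm u \in young).
Proof.
apply/idP/idP => [/morphimP[v _ _ ->] | /young_restrict[t tE]].
  exact: block_embed_young.
pose v : block_prod La :=
  [ffun i => wr_pair (t i) [ffun j : 'I_(bsize La i) => wr_diag u (blk_elt j)]].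
have -> : u = block_embed hn v; last by apply: mem_morphim; rewrite inE.
apply: wr_ext.
  apply/permP; apply: (blk_ind (hn := hn)) => i j.
  by rewrite block_embed_perm ffunE wr_perm_pair tE.
apply/ffunP; apply: (blk_ind (hn := hn)) => i j.
by rewrite block_embed_diag ffunE wr_diag_pair ffunE.
Qed.

Local Notation phi := (cfIsom (block_embed_isom hn) (chi_tensor La)).

Lemma chi_block_perm (s : 'S_n) (t : forall i, 'S_(bsize La i)) :
  (forall i (j : 'I_(bsize La i)), blk_elt (t i j) = s (blk_elt j)) ->
  phi (wr_of_perm d s) = \prod_i specht_char (tnth La i) (t i).
Proof.
move=> tE; pose v : block_prod La := [ffun i => wr_of_perm d (t i)].
have -> : wr_of_perm d s = block_embed hn v.
  apply: wr_ext.
    apply/permP; apply: (blk_ind (hn := hn)) => i j.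
    by rewrite wr_perm_of_perm block_embed_perm ffunE wr_perm_of_perm tE.
  apply/ffunP; apply: (blk_ind (hn := hn)) => i j.
  by rewrite block_embed_diag ffunE !wr_diag_of_perm.
rewrite cfIsomE ?inE // cfunE; apply: eq_bigr => i _.
rewrite /chi cfunE /chi_fun ffunE wr_perm_of_perm big1 ?mulr1 // => j _.
by rewrite wr_diag_of_perm expr1n.
Qed.

(** The diagonal part of y belongs to the subgroup, on which the inducing
    character is a class function. *)
Lemma chi_block_conjg (s : 'S_n) (y : wreath d n) :
  phi (wr_of_perm d s ^ y)%g = phi (wr_of_perm d (s ^ wr_perm y)%g).
Proof.
rewrite -{1}[y]wr_pairK /wr_pair conjgM cfunJ ?mem_block_subgroup.
  by rewrite -morphJ ?inE.
have -> : wr_perm (sdpair1 (permute_gact d n) (wr_diag y)) = 1%g.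
  by rewrite /wr_perm /= val_insubd !inE.
by apply/youngP => k; rewrite perm1.
Qed.

(** * Counting the conjugates of the longest element in the subgroup *)

(** The coset of s modulo the Young subgroup, recorded by the block to which s
    sends each point. *)
Definition word (s : 'S_n) : n.-tuple 'I_d := [tuple blk (s k) | k < n].

Lemma wordP (s : 'S_n) (w : n.-tuple 'I_d) :
  reflect (forall k, blk (s k) = tnth w k) (word s == w).
Proof.
apply: (iffP eqP) => [<- k | E]; first by rewrite tnth_mktuple.
by apply: eq_from_tnth => k; rewrite tnth_mktuple.
Qed.

Lemma conjg_w0_young (s : 'S_n) :
  ((w0 n ^ s)%g \in young) = (rev (word s) == word s).
Proof.
have tnth_revw k : tnth [tuple of rev (word s)] k = blk (s (rev_ord k)).
  rewrite (tnth_nth (blk k)) nth_rev size_tuple //.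
  by rewrite -[(n - k.+1)%N]/(nat_of_ord (rev_ord k)) -tnth_nth tnth_mktuple.
rewrite -[rev (word s)]/(val [tuple of rev (word s)]) val_eqE [RHS]eq_sym.
apply/youngP/wordP => E k; last by rewrite -[k](permKV s) permJ w0E E tnth_revw rev_ordK.
by rewrite tnth_revw -w0E -permJ E.
Qed.

(** The fibre is the left coset of p, since products of permutations apply the
    left factor first. *)
Lemma card_word_fibre (p : 'S_n) : #|[set s | word s == word p]| = #|young|.
Proof.
rewrite -(card_lcoset young p); apply: eq_card => s; rewrite mem_lcoset inE.
apply/wordP/youngP => E k; last by rewrite tnth_mktuple -(E (p k)) permM permK.
by rewrite permM E tnth_mktuple permKV.
Qed.

Lemma perm_eq_word (w : n.-tuple 'I_d) :
  reflect (exists p, w = word p) (perm_eq w (word 1)).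
Proof.
apply: (iffP tuple_permP) => -[p def_w]; exists p.
  by apply/val_inj; rewrite [LHS]def_w; apply: eq_map => k; rewrite tnth_mktuple perm1.
by rewrite def_w; apply: eq_map => k; rewrite tnth_mktuple perm1.
Qed.

Lemma card_conjg_w0_young :
  (#|[set s | (w0 n ^ s)%g \in young]| =
   size (palindromic_rearrangements (word 1)) * #|young|)%N.
Proof.
set pal := palindromic_rearrangements _.
pose P := [pred w : n.-tuple 'I_d | val w \in pal].
have palP (w : seq 'I_d) : (w \in pal) = (rev w == w) && perm_eq w (word 1).
  by rewrite mem_filter mem_permutations.
have -> : size pal = #|P|.
  rewrite cardE -(size_map val); apply: perm_size; apply: uniq_perm => [||w].
  - exact/filter_uniq/permutations_uniq.
  - by rewrite map_inj_uniq ?enum_uniq //; apply: val_inj.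
  apply/idP/mapP => [pal_w | [t + ->]]; last by rewrite mem_enum inE.
  have size_w : size w == n.
    by move: pal_w; rewrite palP => /andP[_ /perm_size->]; rewrite size_tuple.
  by exists (Tuple size_w); rewrite // mem_enum inE.
rewrite -sum1_card (partition_big word P) => [|s]; last first.
  rewrite inE conjg_w0_young /= palP => ->.
  by apply/(perm_eq_word (word s)); exists s.
rewrite -sum_nat_const; apply: eq_bigr => w; rewrite inE /= palP.
case/andP=> pal_w /perm_eq_word[p def_w]; rewrite -(card_word_fibre p) -sum1_card.
apply: eq_bigl => s; rewrite in_set [X in X && _]in_set conjg_w0_young def_w.
by rewrite andbC; have [->|//] := eqVneq (word s) (word p); rewrite -def_w pal_w.
Qed.

Lemma count_word i : count_mem i (word 1) = bsize La i.
Proof.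
rewrite -sum1_count big_map big_enum_cond /= sum1_card.
rewrite -[RHS]card_ord -(card_imset _ (@blk_elt_inj _ _ _ hn i)).
apply: eq_card => k; rewrite -[LHS]topredE /= perm1.
apply/eqP/imsetP => [/ord_inj e | [j _ ->]].
  by have [j <-] := blk_eltP e; exists j.
by rewrite blk_blk_elt.
Qed.

Lemma card_wr_perm_preim (A : {set 'S_n}) :
  (#|[set u : wreath d n | wr_perm u \in A]| = #|A| * #|{dffun 'I_n -> rootU d}|)%N.
Proof.
rewrite -[X in (_ * X)%N]cardsT -cardsX.
have pairK : cancel (fun x => wr_pair x.1 x.2)
    (fun u : wreath d n => (wr_perm u, wr_diag u)).
  by case=> s t; rewrite wr_perm_pair wr_diag_pair.
rewrite -(card_imset _ (can_inj pairK)); apply: eq_card => u; rewrite inE.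
apply/idP/imsetP => [Au | [[s t] + ->]].
  by exists (wr_perm u, wr_diag u); rewrite ?wr_pairK // !inE Au.
by rewrite !inE andbT wr_perm_pair.
Qed.

(** * The value of the induced character *)

Lemma chi_conjg_w0 (s : 'S_n) (sigma : forall i, 'S_(bsize La i)) :
  (forall i, disjoint_transp (bsize La i)./2 (sigma i)) ->
  (w0 n ^ s)%g \in young ->
  phi (wr_of_perm d (w0 n ^ s)%g) = \prod_i specht_char (tnth La i) (sigma i).
Proof.
move=> dt_sigma Yws; have [t tE] := young_restrict Yws.
rewrite (chi_block_perm tE); apply: eq_bigr => i _.
apply: specht_char_near_fixfree (dt_sigma i).
have [wK fix_w] := near_fixfree_conj s (w0_near_fixfree n).
split=> [j | j j' fix_j fix_j']; apply: (@blk_elt_inj _ _ _ hn i).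
  by rewrite !tE wK.
by apply: fix_w; rewrite -tE; congr (blk_elt _).
Qed.

(** In the formula for an induced character, the elements y that conjugate w0
    into the subgroup all give the same term; the number of these y is the order
    of the subgroup times the number of palindromic rearrangements. *)
Lemma chi0_w0 (sigma : forall i, 'S_(bsize La i)) :
  (forall i, disjoint_transp (bsize La i)./2 (sigma i)) ->
  chi0 hn (wr_of_perm d (w0 n)) =
    (size (palindromic_rearrangements (word 1)))%:R
      * \prod_i specht_char (tnth La i) (sigma i).
Proof.
move=> dt_sigma; rewrite /chi0 cfIndE ?subsetT //.
set V := \prod_i _.
pose A := [set s | (w0 n ^ s)%g \in young].
pose B := [set y : wreath d n | wr_perm y \in A].
have BE y : (y \in B) = ((w0 n ^ wr_perm y)%g \in young) by rewrite in_set [LHS]in_set.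
rewrite (bigID (mem B)) /= [X in _ + X]big1 ?addr0; last first.
  move=> y; rewrite in_setT BE => Ny; rewrite chi_block_conjg cfun0 //.
  by rewrite mem_block_subgroup wr_perm_of_perm.
rewrite (eq_bigr (fun=> V)); last first.
  by move=> y; rewrite in_setT BE => Yy; rewrite chi_block_conjg; apply: chi_conjg_w0.
under eq_bigl => y do rewrite in_setT andTb.
rewrite sumr_const card_wr_perm_preim card_conjg_w0_young -mulnA.
have -> : (#|young| * #|{dffun 'I_n -> rootU d}|)%N = #|H|.
  by rewrite -card_wr_perm_preim; apply: eq_card => u; rewrite inE mem_block_subgroup.
by rewrite -[V *+ _]mulr_natl natrM mulrA mulrCA mulVf ?mulr1 ?neq0CG.
Qed.

End BlockSubgroup.

Theorem mainTheorem6 (d n : nat) (d_gt0 : (0 < d)%N) (d_even : ~~ odd d)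
    (n_ge2 : (2 <= n)%N) (La : d.-tuple intpart)
    (hn : (\sum_(i < d) bsize La i)%N = n) :
  (* (a) *)
  ((~~ odd n /\ ~ (forall i : 'I_d, ~~ odd (bsize La i))) \/
   (odd n /\ (1 < #|[set i : 'I_d | odd (bsize La i)]|)%N) ->
   chi0 hn (wr_of_perm d (w0 n)) = 0)
  /\
  (* (b) *)
  ((~~ odd n /\ (forall i : 'I_d, ~~ odd (bsize La i))) \/
   (odd n /\ #|[set i : 'I_d | odd (bsize La i)]| = 1%N) ->
   forall sigma : (forall i : 'I_d, 'S_(bsize La i)),
   (forall i : 'I_d, disjoint_transp (bsize La i)./2 (sigma i)) ->
   chi0 hn (wr_of_perm d (w0 n)) =
     (n./2`!)%:R / (\prod_(i < d) ((bsize La i)./2`!)%:R)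
       * \prod_(i < d) specht_char (tnth La i) (sigma i)).
Proof.
(* The hypotheses of (a) and (b) say whether the number of odd blocks differs
   from the parity of n or is equal to it. *)
have odd_word : #|odd_letters (word hn 1)| = #|[set i | odd (bsize La i)]|.
  by apply: eq_card => i; rewrite !inE count_word.
have evens : (forall i : 'I_d, ~~ odd (bsize La i)) <-> #|[set i | odd (bsize La i)]| = 0.
  split=> [even_La | /eqP + i].
    apply/eqP; rewrite cards_eq0 -subset0; apply/subsetP => i.
    by rewrite inE (negPf (even_La i)).
  rewrite cards_eq0 => /eqP E; apply/negP => odd_i.
  by have := in_set0 i; rewrite -E inE odd_i.
split=> [case_a | case_b sigma dt_sigma].
  rewrite (chi0_w0 hn (fun i => near_fixfree_disjoint_transp (w0_near_fixfree _))).
  have ne : #|odd_letters (word hn 1)| != odd n.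
    rewrite odd_word; apply/eqP => E.
    case: case_a => [[/negPf odd_n] | [odd_n]]; last by rewrite E odd_n.
    by case; apply/evens; rewrite E odd_n.
  rewrite (_ : palindromic_rearrangements _ = [::]) ?mul0r //.
  apply/eqP; rewrite -[_ == _]negbK -has_filter; apply/hasPn => t.
  rewrite mem_permutations => t_w; apply: contra ne => /eqP /card_odd_letters.
  rewrite (perm_size t_w) size_tuple => <-; apply/eqP/eq_card => i.
  by rewrite !inE (seq.permP t_w).
rewrite (chi0_w0 hn dt_sigma); congr (_ * _).
have card_odd : #|odd_letters (word hn 1)| = odd (size (word hn 1)).
  rewrite odd_word size_tuple.
  by case: case_b => [[/negPf-> /evens] | [->]].
have := count_palindromic_rearrangements card_odd.
under eq_bigr => i _ do rewrite count_word.
rewrite size_tuple => <-; rewrite natrM natr_prod mulfK //.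
by apply/prodf_neq0 => i _; rewrite pnatr_eq0 -lt0n fact_gt0.
Qed.
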